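(* Let $K=\{x\in\mathbf{R}^n: g_i(x)\le0,\ i=1,\dots,m\}$ be a nonempty unbounded set, where $g_1,\dots,g_m$ are convex polynomials, and suppose that $K_\infty=\{x\in\mathbf{R}^n: Ax\le0\}$, where $A\in\mathbf{R}^{m\times n}$ has full rank. Let $\mathbf d=(d_1,\dots,d_q)$ with integers $d_i\ge1$. Then the set $\mathbf{GR}^{\mathbf d}$ is generic in $\mathbf{P}_{\mathbf d}$.
   Context: $\mathbf{R}^q_+$ is the nonnegative orthant; vector inequalities are componentwise. The asymptotic cone of a nonempty set $S$ is $S_\infty=\{v:\exists\, t_k\to+\infty,\ x_k\in S \text{ with } x_k/t_k\to v\}$. $\mathbf{P}_{d_i}$ is the space of polynomials on $\mathbf{R}^n$ of degree at most $d_i$, identified with a Euclidean space via coefficient vectors, and $\mathbf{P}_{\mathbf d}=\mathbf{P}_{d_1}\times\cdots\times\mathbf{P}_{d_q}$. A subset is generic if it contains a countable intersection of dense open sets. For a polynomial $r$ of degree $d$, $r^\infty_d(x)=\lim_{t\to+\infty}r(tx)/t^d$, and $SOL(A,r)$ is the set of global minimizers of $r$ over $A$. For a vector polynomial $p=(p_1,\dots,p_q)$ and $\bar x\in K$ put $K_{\bar x}=\{x\in K:p(x)\le p(\bar x)\}$. For a nonempty closed set $S$ and a nonempty $I\subseteq\{1,\dots,q\}$, $p$ is relatively $I$-$\mathbf{R}^q_+$-zero-regular with $S$ on $K$ if there exist $\bar x\in K$ with $(K_{\bar x})_\infty\subseteq S_\infty\subseteq K_\infty$ and $\lambda\in\mathbf{R}^q_+\setminus\{0\}$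 with $\{i:\lambda_i\neq0\}=I$ such that $SOL(S_\infty,\{\sum_{i=1}^q\lambda_i p_i\}^\infty_d)$, $d=\deg\sum_i\lambda_i p_i$, is bounded (possibly empty). $\mathbf{GR}^{\mathbf d}$ is the set of all vector polynomials $p=(p_1,\dots,p_q)$ with $\deg p_i=d_i$ for all $i$ such that, for some set $S$ and some nonempty index set $I\subseteq\{1,\dots,q\}$, $p$ is relatively $I$-$\mathbf{R}^q_+$-zero-regular with $S$ on $K$. *)

(* Defs.v *)
From HB Require Import structures.
From mathcomp Require Import all_boot all_order all_algebra.
From mathcomp Require Import all_classical all_reals all_analysis.
From mathcomp Require Import borel_hierarchy.
(* Some notations of mpoly clash with those of mathcomp-analysis. *)
From mathcomp.multinomials Require Export -(notations) mpoly.

Set Implicit Arguments.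
Unset Strict Implicit.
Unset Printing Implicit Defensive.

Import Order.TTheory GRing.Theory Num.Theory.
Import numFieldNormedType.Exports.
Local Open Scope classical_set_scope.
Local Open Scope ring_scope.

Section Defs.
Context {R : realType}.

Definition peval {n} (r : mpoly n R) (x : 'rV[R]_n) : R :=
  meval (fun i => x 0 i) r.

(* [msize r] is 1 + the degree of [r], and [msize 0 = 0]; hence [pdeg 0 = 0]. *)
Definition pdeg {n} (r : mpoly n R) : nat := (msize r).-1.

Definition convex_poly {n} (r : mpoly n R) : Prop :=
  @convex_function R 'rV[R]_n setT (peval r).

Definition constraint_set {n m} (g : 'I_m -> mpoly n R) : set 'rV[R]_n :=
  [set x | forall i, peval (g i) x <= 0].

Definition asymptotic_cone {n} (S : set 'rV[R]_n) : set 'rV[R]_n :=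
  [set v | exists (t : nat -> R) (x : nat -> 'rV[R]_n),
     [/\ t k @[k --> \oo] --> +oo%R, (forall k, S (x k)) &
         (t k)^-1 *: x k @[k --> \oo] --> v]].

(* The function r^oo_d. *)
Definition recession {n} (d : nat) (r : mpoly n R) (x : 'rV[R]_n) : R :=
  lim (peval r (t *: x) / t ^+ d @[t --> +oo%R]).

Definition SOL {n} (A : set 'rV[R]_n) (f : 'rV[R]_n -> R) : set 'rV[R]_n :=
  [set x | A x /\ forall y, A y -> f x <= f y].

(* The set K_xbar. *)
Definition sublevel {n q} (K : set 'rV[R]_n) (p : 'I_q -> mpoly n R)
    (xbar : 'rV[R]_n) : set 'rV[R]_n :=
  [set x | K x /\ forall i, peval (p i) x <= peval (p i) xbar].

Definition weighted_sum {n q} (lambda : 'rV[R]_q) (p : 'I_q -> mpoly n R) :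
    mpoly n R :=
  \sum_(i < q) lambda 0 i *: p i.

Definition zero_regular {n q} (K S : set 'rV[R]_n) (I : set 'I_q)
    (p : 'I_q -> mpoly n R) : Prop :=
  (exists xbar, [/\ K xbar,
     asymptotic_cone (sublevel K p xbar) `<=` asymptotic_cone S &
     asymptotic_cone S `<=` asymptotic_cone K]) /\
  (exists lambda : 'rV[R]_q, [/\ forall i, 0 <= lambda 0 i, lambda != 0,
     [set i | lambda 0 i != 0] = I &
     let r := weighted_sum lambda p in
     bounded_set (SOL (asymptotic_cone S) (recession (pdeg r) r))]).

Definition GR {n q} (K : set 'rV[R]_n) (d : 'I_q -> nat) :
    set ('I_q -> mpoly n R) :=
  [set p | (forall i, pdeg (p i) = d i) /\
     exists (S : set 'rV[R]_n) (I : set 'I_q),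
       [/\ S !=set0, closed S, I !=set0 & zero_regular K S I p]].

(* The coefficient vectors of the polynomials of degree at most [d] in [n]
   variables: [bmultinom n d.+1] is the type of monomials of degree < d.+1. *)
Local Notation coef_space n d := 'rV[R]_#|{: bmultinom n d.+1}|.

Definition poly_of_coef {n d} (c : coef_space n d) : mpoly n R :=
  \sum_(m : bmultinom n d.+1) c 0 (enum_rank m) *: mpolyX R (bmnm m).

(* P_d = P_{d_1} x ... x P_{d_q}, with the product topology. *)
Definition vcoef_space (n q : nat) (d : 'I_q -> nat) : topologicalType :=
  prod_topology (fun i : 'I_q => coef_space n (d i)).

Definition vpoly_of_coef {n q} {d : 'I_q -> nat} (c : vcoef_space n d) :
    'I_q -> mpoly n R :=
  fun i => poly_of_coef (c i).

(* [poly_of_coef] identifies [coef_space n d] with the polynomials of degree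
   at most [d]. *)
Lemma poly_of_coef_inj n d : injective (@poly_of_coef n d).
Proof.
have coefE (c : coef_space n d) (m : bmultinom n d.+1) :
    mcoeff (bmnm m) (poly_of_coef c) = c 0 (enum_rank m).
  rewrite /poly_of_coef raddf_sum (bigD1 m)//= mcoeffZ mcoeffX eqxx mulr1.
  rewrite big1 ?addr0// => m' m'm; rewrite mcoeffZ mcoeffX.
  by rewrite (inj_eq val_inj) (negbTE m'm) mulr0.
move=> c c' cc'; apply/rowP => j.
by rewrite -[j]enum_valK -!coefE cc'.
Qed.

Lemma poly_of_coef_range n d :
  range (@poly_of_coef n d) = [set r | (pdeg r <= d)%N].
Proof.
have msz (r : mpoly n R) : (pdeg r <= d)%N = (msize r <= d.+1)%N.
  by rewrite /pdeg; case: (msize r).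
apply/seteqP; split => [r [c _ <-]|r /=]; rewrite /= msz.
- apply: (leq_trans (msize_sum _ _ _)); apply/bigmax_leqP => m _.
  by apply: leq_trans (msizeZ_le _ _) _; rewrite msizeX; exact: bmdeg.
- move=> rd; exists (\row_j mcoeff (bmnm (enum_val j)) r) => //.
  rewrite /poly_of_coef [RHS](mpolywE (k := d.+1))//.
  by apply: eq_bigr => m _; rewrite mxE enum_rankK.
Qed.

End Defs.

Arguments vcoef_space R n {q} d.

Definition generic {T : topologicalType} (S : set T) : Prop :=
  exists2 G : set T, Gdelta_dense G & G `<=` S.

(* Main.v *)
Require Import Defs.
From HB Require Import structures.
From mathcomp Require Import all_boot all_order all_algebra.
From mathcomp Require Import all_classical all_reals all_analysis.
From mathcomp.multinomials Require Import -(notations) mpoly.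
Import Order.TTheory GRing.Theory Num.Theory.
Import numFieldNormedType.Exports.
Local Open Scope classical_set_scope.
Local Open Scope ring_scope.

(** Take [S = K] and a weight vector concentrated on a single index [i].  The
sublevel sets of [p] lie in [K], so the inclusions between asymptotic cones
hold, and the weighted sum is [p_i] itself.  Everything thus reduces to
one polynomial: for generic coefficients, [p_i] should have degree exactly
[d_i] and its leading form [h], which is its recession function, should have
a bounded set of minimizers over the cone [C], the asymptotic cone of [K].

Let [N] be the set of coefficient vectors whose leading form is negative
somewhere on [C].  It is open, since [h x] is a continuous function of the
coefficients, hence the union of [N] and of its exterior is open and dense
([dense_setU_exterior]).  On that set the minimizers reduce at most to [0]
([SOL_leading_form_sub0]).  By homogeneity, [h] vanishes at any minimizer [x]
over a cone ([SOL_leading_form_eq0]), so [h] is nonnegative on [C] and the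
coefficients are not in [N]; if they are exterior to [N] and [x <> 0], adding
a small multiple of a monomial [x_j ^ d] with [x_j <> 0], of the appropriate
sign, makes [h x] negative without leaving the exterior, a contradiction.

Degree exactly [d_i] is ensured by one more open dense condition, that the
coefficient of a fixed monomial of degree [d_i] be nonzero.  Such a monomial
needs a variable, and there is one because [K] is unbounded.  Both conditions
concern one factor of the product space at a time, and a box with open dense
sides is generic ([generic_box]). *)

(** * Open dense sets *)

(** An open set that misses [U] is contained in its exterior.  This yields open
dense sets without any knowledge of the boundary of [U]. *)
Lemma dense_setU_exterior (T : topologicalType) (U : set T) :
  dense (U `|` interior (~` U)).
Proof.
move=> O O0 oO; have [[z [Oz Uz]]|OU0] := pselect (O `&` U !=set0).
  by exists z; split => //; left.
have [z Oz] := O0; exists z; split => //; right.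
apply: filterS (open_nbhs_nbhs (conj oO Oz)) => y Oy Uy.
by apply: OU0; exists y.
Qed.

(** Projections of a product space are open maps, and preimages of dense sets
under open maps are dense. *)
Lemma dense_proj_preimage (I : eqType) (K : I -> topologicalType) (i : I)
    (U : set (K i)) :
  dense U -> dense [set f : prod_topology K | U (f i)].
Proof.
move=> dU O [f Of] oO.
have [|_ [[h Oh <-] Uh]] := dU _ _ (proj_open i oO).
  by exists (f i), f.
by exists h.
Qed.

(** The box is the intersection of the preimages of its sides under the
projections, each of which is open and dense. *)
Lemma generic_box (q : nat) (K : 'I_q -> topologicalType)
    (U : forall i, set (K i)) :
  (forall i, open (U i)) -> (forall i, dense (U i)) ->
  generic [set f : prod_topology K | forall i, U i (f i)].
Proof.
move=> oU dU.
(* A countable family is required: the indices k >= q contribute the whole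
   space. *)
pose F (k : nat) : set (prod_topology K) :=
  if insub k is Some i then [set f | U i (f i)] else setT.
exists (\bigcap_k F k).
  exists F => // k; rewrite /F; case: insubP => [i _ _|_].
    split; last exact: dense_proj_preimage.
    have := @open_comp (prod_topology K) (K i) (@proj _ K i) (U i).
    by apply=> // f _; exact: proj_continuous.
  by split; [exact: openT | move=> O [x Ox] _; exists x].
by move=> f Ff i; have := Ff i I; rewrite /F valK.
Qed.

Lemma open_perturb (R : realType) (V : normedModType R) (O : set V) (c e : V) :
  open O -> O c -> exists2 s : R, 0 < s & O (c + s *: e).
Proof.
move=> oO Oc.
have cvgc : c + s *: e @[s --> 0^'+] --> c.
  have : continuous (fun s : R => c + s *: e).
    move=> s; apply: cvgD; first exact: cvg_cst.
    by apply: cvgZr_tmp; exact: cvg_id.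
  move=> /(_ 0) h; apply: cvg_at_right_filter; move: h.
  by rewrite /continuous_at scale0r addr0.
have [s [s0 Os]] : exists s : R, 0 < s /\ O (c + s *: e).
  apply: (@filter_ex _ (0^'+ : set_system R)).
  apply: filterI; first exact: nbhs_right_gt.
  by apply: cvgc; exact: open_nbhs_nbhs.
by exists s.
Qed.

Lemma open_coef_neq0 (R : realType) (N : nat) (j : 'I_N) :
  open [set c : 'rV[R]_N | c 0 j != 0].
Proof.
have := @open_comp _ _ (fun c : 'rV[R]_N => c 0 j) [set y | y != 0].
by apply=> [c _|]; [exact: coord_continuous | exact: open_neq].
Qed.

Lemma dense_coef_neq0 (R : realType) (N : nat) (j : 'I_N) :
  dense [set c : 'rV[R]_N | c 0 j != 0].
Proof.
move=> O [c Oc] oO.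
have [cj0|cj0] := eqVneq (c 0 j) 0; last by exists c.
have [s s0 Os] := open_perturb _ _ _ _ (delta_mx 0 j) oO Oc.
exists (c + s *: delta_mx 0 j); split => //=.
by rewrite !mxE cj0 !eqxx add0r mulr1 gt_eqF.
Qed.

(** * Evaluation and leading forms *)

Section LeadingForm.
Context {R : realType} {n : nat}.
Implicit Types (x : 'rV[R]_n) (t : R).

Lemma continuous_peval (r : mpoly n R) : continuous (peval r).
Proof.
rewrite (_ : peval r = fun x : 'rV[R]_n => \sum_(mu <- msupp r)
    mcoeff mu r * \prod_(i < n) x 0 i ^+ mu i).
  apply: continuous_big => [|mu _]; first exact: add_continuous.
  move=> x; have : \prod_(i < n) y 0 i ^+ mu i @[y --> x] -->
      \prod_(i < n) x 0 i ^+ mu i; last exact: cvgMl_tmp.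
  apply: cvg_big => [|i _].
    by move=> z; apply: cvgM; [exact: cvg_fst | exact: cvg_snd].
  have xi : y 0 i @[y --> x] --> x 0 i by exact: coord_continuous.
  exact: (cvg_comp _ _ xi (@exprn_continuous _ (mu i) _)).
by apply/funext => x; rewrite /peval mevalE.
Qed.

Lemma pevalZX (mu : multinom n) t x :
  peval (mpolyX R mu) (t *: x) = t ^+ mdeg mu * peval (mpolyX R mu) x.
Proof.
rewrite /peval !mevalX mdegE -prodrXr -big_split/=.
by apply: eq_bigr => i _; rewrite mxE exprMn.
Qed.

Context {d : nat}.
Implicit Types c e : 'rV[R]_#|{: bmultinom n d.+1}|.

Lemma peval_poly_of_coef c x : peval (poly_of_coef c) x =
  \sum_(mu : bmultinom n d.+1) c 0 (enum_rank mu) * peval (mpolyX R mu) x.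
Proof.
rewrite /peval /poly_of_coef raddf_sum/=; apply: eq_bigr => mu _.
by rewrite mevalZ.
Qed.

Definition leading_form c x : R :=
  \sum_(mu : bmultinom n d.+1 | mdeg mu == d)
    c 0 (enum_rank mu) * peval (mpolyX R mu) x.

(** A monomial of degree [k] contributes [t ^ (k - d)] times its value at [x],
which is constant for [k = d] and vanishes at infinity for [k < d]. *)
Lemma recession_poly_of_coef c :
  recession d (poly_of_coef c) = leading_form c.
Proof.
apply/funext => x; rewrite /recession; apply: cvg_lim => //.
pose a (mu : bmultinom n d.+1) := c 0 (enum_rank mu) * peval (mpolyX R mu) x.
rewrite /leading_form big_mkcond/=.
have : \sum_(mu : bmultinom n d.+1) a mu * (t ^+ mdeg mu / t ^+ d)
    @[t --> +oo] --> \sum_(mu : bmultinom n d.+1)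
      (if mdeg mu == d then a mu else 0).
  apply: cvg_big => [|mu _]; first exact: add_continuous.
  have [mud|mud] := eqVneq (mdeg mu) d.
    apply: cvg_near_cst; near=> t.
    by rewrite mud divff ?mulr1// expf_neq0// gt_eqF.
  have {mud}: (mdeg mu < d)%N by rewrite ltn_neqAle mud -ltnS bmdeg.
  rewrite -subn_gt0; case E : (d - mdeg mu)%N => [//|k] _.
  rewrite -(mulr0 (a mu)); apply: cvgMl_tmp.
  have V0 : t^-1 @[t --> +oo] --> (0 : R).
    by apply/gtr0_cvgV0; [near=> t | exact: cvg_id].
  have Vpow : t^-1 ^+ k.+1 @[t --> +oo] --> (0 : R).
    have := cvg_comp _ _ V0 (@exprn_continuous R k.+1 0).
    by rewrite expr0n.
  apply: cvg_trans Vpow; apply: near_eq_cvg; near=> t.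
  have -> : t ^+ d = t ^+ mdeg mu * t ^+ k.+1.
    by rewrite -exprD -E subnKC// -ltnS bmdeg.
  by rewrite exprVn invfM mulrA divff ?mul1r// expf_neq0// gt_eqF.
apply: cvg_trans; apply: near_eq_cvg; near=> t.
rewrite peval_poly_of_coef mulr_suml; apply: eq_bigr => mu _.
by rewrite pevalZX [c 0 _ * _]mulrCA -/(a mu) -[RHS]mulrA [RHS]mulrCA.
Unshelve. all: by end_near. Qed.

Lemma leading_formZ c t x :
  leading_form c (t *: x) = t ^+ d * leading_form c x.
Proof.
rewrite /leading_form mulr_sumr; apply: eq_bigr => mu /eqP mud.
by rewrite pevalZX mud mulrCA.
Qed.

Lemma leading_form_perturb c e t x :
  leading_form (c + t *: e) x = leading_form c x + t * leading_form e x.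
Proof.
rewrite /leading_form mulr_sumr -big_split/=; apply: eq_bigr => mu _.
by rewrite !mxE mulrDl mulrA.
Qed.

Lemma continuous_leading_form x : continuous (leading_form ^~ x).
Proof.
apply: continuous_big => [|mu _]; first exact: add_continuous.
move=> c; have cmu : c' 0 (enum_rank mu) @[c' --> c] --> c 0 (enum_rank mu).
  exact: coord_continuous.
exact: (cvgMr_tmp cmu).
Qed.

Lemma leading_form_delta (mu : bmultinom n d.+1) t x : mdeg mu = d ->
  leading_form (t *: delta_mx 0 (enum_rank mu)) x = t * peval (mpolyX R mu) x.
Proof.
move=> mud; rewrite /leading_form (bigD1 mu) ?mud//= big1 ?addr0.
  by rewrite !mxE !eqxx mulr1.
move=> nu /andP[_ numu].
by rewrite !mxE eqxx (inj_eq enum_rank_inj) (negbTE numu) mulr0 mul0r.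
Qed.

Lemma pure_power_proof (j : 'I_n) : (mdeg (mnm_muln (mnm1 j) d) < d.+1)%N.
Proof. by rewrite mdegMn mdeg1 mul1n. Qed.

Definition pure_power j : bmultinom n d.+1 := BMultinom (pure_power_proof j).

Lemma mdeg_pure_power j : mdeg (pure_power j) = d.
Proof. by rewrite /= mdegMn mdeg1 mul1n. Qed.

Lemma peval_pure_power j x : peval (mpolyX R (pure_power j)) x = x 0 j ^+ d.
Proof.
rewrite /peval mevalX (bigD1 j)//= big1 ?mulr1.
  by rewrite mulmnE mnm1E eqxx mul1n.
by move=> i ij; rewrite mulmnE mnm1E eq_sym (negbTE ij) mul0n expr0.
Qed.

(** The monomial [x_j ^ d] does not vanish at [x] when [x_j <> 0], and the sign
of its coefficient is free. *)
Lemma leading_form_lt0_exists x : x != 0 -> exists e, leading_form e x < 0.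
Proof.
move=> /rV0Pn[j xj0].
exists (- (x 0 j ^+ d) *: delta_mx 0 (enum_rank (pure_power j))).
rewrite leading_form_delta ?mdeg_pure_power// peval_pure_power.
by rewrite mulNr oppr_lt0 -expr2 exprn_even_gt0//= expf_neq0.
Qed.

Lemma pdeg_poly_of_coef c (mu : bmultinom n d.+1) :
  mdeg mu = d -> c 0 (enum_rank mu) != 0 -> pdeg (poly_of_coef c) = d.
Proof.
move=> mud cmu; apply/eqP; rewrite eqn_leq; apply/andP; split.
  by have : range (@poly_of_coef R n d) (poly_of_coef c);
    [exists c | rewrite poly_of_coef_range].
have : (mdeg mu < msize (poly_of_coef c))%N.
  apply: msize_mdeg_lt; rewrite mcoeff_msupp /poly_of_coef raddf_sum/=.
  rewrite (bigD1 mu)//= mcoeffZ mcoeffX eqxx mulr1 big1 ?addr0//.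
  move=> nu numu; rewrite mcoeffZ mcoeffX (inj_eq val_inj) (negbTE numu).
  by rewrite mulr0.
by rewrite mud /pdeg; case: (msize _).
Qed.

(** * Minimizers of leading forms over cones *)

Definition neg_somewhere (C : set 'rV[R]_n) :
    set 'rV[R]_#|{: bmultinom n d.+1}| :=
  [set c | exists2 x, C x & leading_form c x < 0].

Lemma open_neg_somewhere C : open (neg_somewhere C).
Proof.
rewrite (_ : neg_somewhere C =
    \bigcup_(x in C) [set c | leading_form c x < 0]).
  apply: bigcup_open => x _.
  have := @open_comp _ _ (leading_form ^~ x) [set y | y < 0].
  by apply=> [c _|]; [exact: continuous_leading_form | exact: open_lt].
by apply/seteqP; split=> c [x]; exists x.
Qed.

(** Moving a minimizer [x] along its ray multiplies the value by [t ^ d], so the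
value can be neither positive (take [t = 1/2]) nor negative (take [t = 2]). *)
Lemma SOL_leading_form_eq0 (C : set 'rV[R]_n) c x : (0 < d)%N ->
  (forall t x, 0 < t -> C x -> C (t *: x)) ->
  SOL C (leading_form c) x -> leading_form c x = 0.
Proof.
move=> d0 Ccone [Cx xmin]; apply/eqP; rewrite eq_le; apply/andP; split.
  have := xmin (2^-1 *: x) (Ccone _ _ _ Cx); rewrite invr_gt0 ltr0n => /(_ isT).
  rewrite leading_formZ -subr_ge0 -{2}[leading_form c x]mul1r -mulrBl.
  rewrite nmulr_rge0// subr_lt0 exprn_ilt1// -?lt0n// ?invr_ge0//.
  by rewrite invf_lt1// ltr1n.
have := xmin (2 *: x) (Ccone _ _ _ Cx); rewrite ltr0n => /(_ isT).
rewrite leading_formZ -subr_ge0 -{2}[leading_form c x]mul1r -mulrBl.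
by rewrite pmulr_rge0// subr_gt0 exprn_egt1// -?lt0n// ltr1n.
Qed.

(** A nonzero minimizer is a zero of a form that is nonnegative on the cone, and
such a form is a limit of forms that are negative at that point: this can only
happen on the boundary of [neg_somewhere C]. *)
Lemma SOL_leading_form_sub0 (C : set 'rV[R]_n) c : (0 < d)%N ->
  (forall t x, 0 < t -> C x -> C (t *: x)) ->
  (neg_somewhere C `|` interior (~` neg_somewhere C)) c ->
  SOL C (leading_form c) `<=` [set 0].
Proof.
move=> d0 Ccone cgood x xmin.
have fx0 := SOL_leading_form_eq0 _ _ _ d0 Ccone xmin.
have [Cx xle] := xmin.
case: cgood => [[y Cy]|]; first by rewrite ltNge -fx0 xle.
rewrite /interior/= nbhsE; case=> O [oO Oc] Oneg.
apply/eqP/negPn/negP => x0.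
have [e ex0] := leading_form_lt0_exists x x0.
have [s s0 Os] := open_perturb _ _ _ _ e oO Oc.
apply: (Oneg _ Os); exists x => //.
by rewrite leading_form_perturb fx0 add0r pmulr_rlt0.
Qed.

End LeadingForm.

(** * Asymptotic cones and constraint sets *)

Lemma asymptotic_coneZ (R : realType) (n : nat) (S : set 'rV[R]_n) (s : R) v :
  0 < s -> asymptotic_cone S v -> asymptotic_cone S (s *: v).
Proof.
move=> s0 [t [x [ty Sx xv]]]; exists (fun k => t k * s^-1), x; split => //.
  apply/cvgryPge => M; move/cvgryPge: ty => /(_ (M * s)).
  by apply: filterS => k; rewrite ler_pdivlMr.
under eq_cvg do rewrite invfM invrK mulrC -scalerA.
by apply: cvgZl_tmp.
Qed.

Lemma asymptotic_coneS (R : realType) (n : nat) (S T : set 'rV[R]_n) :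
  S `<=` T -> asymptotic_cone S `<=` asymptotic_cone T.
Proof.
by move=> ST v [t [x [ty Sx xv]]]; exists t, x; split=> // k; exact: ST.
Qed.

Lemma closed_constraint_set (R : realType) (n m : nat) (g : 'I_m -> mpoly n R) :
  closed (constraint_set g).
Proof.
rewrite (_ : constraint_set g =
    \bigcap_(i in setT) (peval (g i) @^-1` [set y | y <= 0])).
  apply: closed_bigI => i _; apply: closed_comp; last exact: closed_le.
  by move=> x _; exact: continuous_peval.
by apply/seteqP; split=> [x Kx i _|x Kx i]; exact: Kx.
Qed.

Theorem theorem19 (R : realType) (n m q : nat)
    (g : 'I_m -> mpoly n R) (A : 'M[R]_(m, n)) (d : 'I_q -> nat) :
  let K := constraint_set g in
  (0 < q)%N ->
  (forall i, convex_poly (g i)) ->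
  K !=set0 ->
  ~ bounded_set K ->
  asymptotic_cone K = [set x : 'rV[R]_n | forall i, (A *m x^T) i 0 <= 0] ->
  \rank A = minn m n ->
  (forall i, 1 <= d i)%N ->
  generic [set c : vcoef_space R n d | GR K d (vpoly_of_coef c)].
Proof.
move=> K q0 _ [xbar Kxbar] Kunb _ _ d1.
(* In dimension 0 every set is bounded. *)
have n0 : (0 < n)%N.
  rewrite lt0n; apply/eqP => n0; apply: Kunb; subst n.
  exists 0; split => // M M0 x _.
  by rewrite /= (thinmx0 x) normr0 ltW.
pose mu i := @pure_power n (d i) (Ordinal n0).
pose N i : set 'rV[R]_#|{: bmultinom n (d i).+1}| :=
  neg_somewhere (asymptotic_cone K).
pose U i := [set c : 'rV[R]_#|{: bmultinom n (d i).+1}| |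
  c 0 (enum_rank (mu i)) != 0] `&` (N i `|` interior (~` N i)).
have oU i : open (U i).
  apply: openI; first exact: open_coef_neq0.
  by apply: openU; [exact: open_neg_somewhere | exact: open_interior].
have dU i : dense (U i).
  apply: denseI; [exact: open_coef_neq0|exact: dense_coef_neq0|].
  exact: dense_setU_exterior.
have [G Gd GU] := generic_box _ _ U oU dU.
exists G => // c /GU Uc; have degc i : pdeg (vpoly_of_coef c i) = d i.
  by apply: (pdeg_poly_of_coef _ (mu i)); [exact: mdeg_pure_power | case: (Uc i)].
split => //; pose i0 := Ordinal q0.
exists K, [set i0]; split.
- by exists xbar.
- exact: closed_constraint_set.
- by exists i0.
split.
  by exists xbar; split => //; apply: asymptotic_coneS => x [].
exists (delta_mx 0 i0); split.
- by move=> i; rewrite mxE ler0n.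
- by apply/rV0Pn; exists i0; rewrite mxE !eqxx oner_neq0.
- apply/seteqP; split => i /=; rewrite mxE eqxx/=.
    by have [->|] := eqVneq i i0; rewrite //= eqxx.
  by move=> ->; rewrite eqxx oner_neq0.
have -> : weighted_sum (delta_mx 0 i0) (vpoly_of_coef c) = vpoly_of_coef c i0.
  rewrite /weighted_sum (bigD1 i0)//= mxE !eqxx scale1r big1 ?addr0//.
  by move=> i ii0; rewrite mxE (negbTE ii0) scale0r.
rewrite /= degc recession_poly_of_coef.
exists 0; split => // M M0 x xmin.
have -> : x = 0.
  apply: (SOL_leading_form_sub0 _ _ (d1 i0) _ (proj2 (Uc i0)) _ xmin).
  by move=> t y; exact: asymptotic_coneZ.
by rewrite /= normr0 ltW.
Qed.
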